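(* Let $X, U$ be two independent random matrices taking values in $\mathcal{S}_d$ and $\mathcal{S}_d^{+}$, respectively, where $U$ is super-uniform. For any deterministic $A \in \mathcal{S}_d^{++}$ and $0< q \leq 1$, $$\mathbb{P}\left(|X-\mathbb{E} X| \succeq \left(A^{q/2}UA^{q/2}\right)^{1/q}\right) \leq \frac{1}{d} \operatorname{tr}\left(\left[\mathbb{E}\left|X-\mathbb{E}X\right|^q\right] A^{-q}\right).$$
   Context: $\mathcal{S}_d$ denotes the set of $d\times d$ real symmetric matrices, $\mathcal{S}_d^{+}$ the positive semidefinite ones and $\mathcal{S}_d^{++}$ the positive definite ones. The Loewner order: for $A,B\in\mathcal{S}_d$, $A \preceq B$ (equivalently $B\succeq A$) means $B-A$ is positive semidefinite. An $\mathcal{S}_d^{+}$-valued random matrix $U$ is called super-uniform if $\mathbb{P}(U \preceq Z) \leq \operatorname{tr}(Z)/d$ for all (deterministic) $Z \in \mathcal{S}_d^{+}$. Scalar functions (absolute value, powers of positive semidefinite matrices) are applied to symmetric matrices through the eigenvalues in an orthogonal diagonalization. Expectations of random matrices are entrywise and are assumed to exist when written. *)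

(* Defs.v *)
From HB Require Import structures.
From mathcomp Require Import all_boot all_order all_algebra.
From mathcomp Require Import all_classical all_reals all_analysis.

Set Implicit Arguments.
Unset Strict Implicit.
Unset Printing Implicit Defensive.

Import Order.TTheory GRing.Theory Num.Theory.
Import numFieldNormedType.Exports.

Local Open Scope classical_set_scope.
Local Open Scope ring_scope.

Section symmetric_matrices.
Context {R : realType} {d : nat}.
Implicit Types A B Q : 'M[R]_d.

Definition psd_mx A : Prop :=
  A \is symmetricmx /\ forall v : 'cV[R]_d, 0 <= (v^T *m A *m v) 0 0.

Definition pd_mx A : Prop :=
  A \is symmetricmx /\
  forall v : 'cV[R]_d, v != 0 -> 0 < (v^T *m A *m v) 0 0.

Definition loewner_le A B : Prop := psd_mx (B - A).

Definition orthogonal_mx Q : Prop := Q *m Q^T = 1%:M.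

(* The set below is a singleton whenever A is symmetric, by the spectral
   theorem and because the result does not depend on the diagonalization;
   xget then returns its element. The value 0 for other A is irrelevant. *)
Definition mx_apply (f : R -> R) A : 'M[R]_d :=
  xget 0 [set B | exists Q (l : 'rV[R]_d),
    [/\ orthogonal_mx Q,
        A = Q *m diag_mx l *m Q^T &
        B = Q *m diag_mx (map_mx f l) *m Q^T]].

Definition mx_abs A : 'M[R]_d := mx_apply (fun x => `|x|) A.

(* Real power of a positive semidefinite matrix; negative exponents are only
   meaningful for positive definite matrices (in R, 0 `^ p = 0 if p != 0). *)
Definition mx_pow A (p : R) : 'M[R]_d := mx_apply (fun x => x `^ p) A.

End symmetric_matrices.

(* d x d real matrices with their Borel sigma-algebra. *)
Definition borel_mx (R : realType) (d : nat) :=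
  g_sigma_algebraType (@open 'M[R]_d).

Section random_matrices.
Context {disp : measure_display} {T : measurableType disp} {R : realType}.
Context (P : probability T R).

Definition independent_RV {d1 d2 : measure_display}
    {T1 : measurableType d1} {T2 : measurableType d2}
    (X : {RV P >-> T1}) (Y : {RV P >-> T2}) : Prop :=
  forall (B1 : set T1) (B2 : set T2), measurable B1 -> measurable B2 ->
    P (X @^-1` B1 `&` Y @^-1` B2) = (P (X @^-1` B1) * P (Y @^-1` B2))%E.

Context {d : nat}.

Definition mx_integrable (Y : T -> 'M[R]_d) : Prop :=
  forall i j, P.-integrable setT (EFin \o (fun w => Y w i j)).

Definition mx_expectation (Y : T -> 'M[R]_d) : 'M[R]_d :=
  \matrix_(i, j) fine ('E_P[fun w => Y w i j])%E.

Definition super_uniform (U : {RV P >-> borel_mx R d}) : Prop :=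
  (forall w, psd_mx (U w)) /\
  forall Z : 'M[R]_d, psd_mx Z ->
    (P [set w | loewner_le (U w) Z] <= (\tr Z / d%:R)%:E)%E.

End random_matrices.

(* Main.v *)
Require Import Defs.
From HB Require Import structures.
From mathcomp Require Import all_boot all_order all_algebra.
From mathcomp Require Import all_classical all_reals all_analysis.
From mathcomp Require Import measurable_realfun complex spectral ring lra.

Set Implicit Arguments.
Unset Strict Implicit.
Unset Printing Implicit Defensive.

Import Order.TTheory GRing.Theory Num.Theory.
Import numFieldNormedType.Exports.

Local Open Scope classical_set_scope.
Local Open Scope ring_scope.

(* Put Y = |X - EX|, H = A^(q/2) and K = A^(-q/2). By the Loewner-Heinz
   inequality, (H U H)^(1/q) <= Y implies H U H <= Y^q, i.e.
   U <= W(X) := K Y^q K. Since U is independent of X, Fubini's theorem and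
   super-uniformity bound the probability of this event by
   E [tr W(X)] / d = tr (E [Y^q] A^(-q)) / d.
   A probability is monotone only on measurable sets, so the events must be
   shown to be Borel: on symmetric matrices the preimage of a closed set under a
   continuous functional calculus is a countable union of compact sets. *)

(** * Real spectral theorem *)

Section spectral.
Context {R : realType}.

Lemma symmetricmxP d (A : 'M[R]_d) : reflect (A^T = A) (A \is symmetricmx).
Proof.
apply: (iffP (is_hermitianmxP _ _ _)); rewrite expr0 scale1r map_mx_id //.
Qed.

(** Over the complex numbers the matrix is Hermitian, so it is unitarily diagonalizable with real
    spectrum. Its first diagonal entry is a root of the characteristic polynomial, and being a root
    descends to the reals. *)
Lemma symmetric_eigenvalue d (A : 'M[R]_d.+1) :
  A^T = A -> exists a, eigenvalue A a.
Proof.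
move=> symA; set B := map_mx (real_complex R) A.
have realB : B \is a mxOver Num.real.
  by apply/mxOverP => i j; rewrite mxE; apply/complex_realP; exists (A i j).
have hermB : B \is hermsymmx.
  apply: realsym_hermsym => //; apply/is_hermitianmxP.
  by rewrite expr0 scale1r map_mx_id// map_trmx symA.
have /orthomx_spectralP := hermitian_normalmx hermB.
move=> /(congr1 (mulmx (spectralmx B))).
rewrite -mulmxA mulKVmx ?spectral_unit//.
move=> /(congr1 (row ord0)).
rewrite !row_mul row_diag_mx -scalemxAl -rowE => eqB.
have /complex_realP[a aE] :=
  mxOverP (hermitian_spectral_diag_real hermB) 0 ord0.
exists a; rewrite eigenvalue_root_char -(fmorph_root (real_complex R)).
rewrite map_char_poly [X in root _ X](esym aE) -eigenvalue_root_char.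
apply/eigenvalueP; exists (row ord0 (spectralmx B)); first exact: eqB.
have := spectral_unit B; rewrite -row_free_unit; apply: contraTneq => row0.
by apply/negP => /row_freePn; apply; exists ord0; rewrite row0 sub0mx.
Qed.

Lemma sqr_col_ge0 d (v : 'cV[R]_d) : 0 <= (v^T *m v) 0 0.
Proof. by rewrite mxE sumr_ge0// => i _; rewrite mxE -expr2 sqr_ge0. Qed.

Lemma sqr_col_gt0 d (v : 'cV[R]_d) : v != 0 -> 0 < (v^T *m v) 0 0.
Proof.
move=> v0; rewrite lt_neqAle sqr_col_ge0 andbT eq_sym.
apply: contraNneq v0 => /eqP; rewrite mxE psumr_eq0 => [/allP v0|i _].
  apply/eqP/colP => i; rewrite mxE; apply/eqP.
  by have := v0 i (mem_index_enum _); rewrite mxE mulf_eq0 orbb.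
by rewrite mxE -expr2 sqr_ge0.
Qed.

Lemma mulmx11 d m (v : 'M[R]_(m, 1)) (a : 'M[R]_(1, 1)) (w : 'M[R]_(1, d)) :
  v *m a *m w = a 0 0 *: (v *m w).
Proof. by rewrite {1}[a]mx11_scalar mul_mx_scalar scalemxAl. Qed.

(* A Householder reflection swaps the two unit vectors. *)
Lemma orthogonal_swap d (v w : 'cV[R]_d) : v^T *m v = w^T *m w ->
  exists H : 'M[R]_d, [/\ H^T = H, H *m H = 1%:M & H *m w = v].
Proof.
move=> vw; have [->|vNw] := eqVneq w v.
  by exists 1%:M; rewrite trmx1 !mul1mx.
pose u := w - v; pose s : R := (u^T *m u) 0 0.
have s_gt0 : 0 < s by rewrite sqr_col_gt0// subr_eq0.
have wv : w^T *m v = v^T *m w.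
  apply/matrixP => i j; rewrite !ord1 !mxE.
  by apply: eq_bigr => k _; rewrite !mxE mulrC.
(* Equal norms give [s] = 2(w^T w - v^T w) = 2 u^T w, so the reflection along [u] sends [w] to w - u
   = v. *)
have uw : (u^T *m w) 0 0 = s / 2.
  rewrite /s /u linearB/= !mulmxBl !mulmxBr vw wv opprB addrA.
  rewrite addrAC [w^T *m w + _ - _]addrAC.
  move: (w^T *m w) (v^T *m w) => a b.
  by rewrite !mxE; field.
exists (1%:M - (2 / s) *: (u *m u^T)); split.
- by rewrite linearB/= linearZ/= trmx_mul trmxK trmx1.
- rewrite mulmxBl mul1mx mulmxBr mulmx1 -scalemxAl -scalemxAr mulmxA.
  rewrite -[u *m u^T *m u]mulmxA mulmx11 -/s opprB -addrA scalerA scalerA.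
  rewrite addrA -[RHS]addr0 -!addrA; congr (_ + _).
  rewrite -!scaleNr -!scalerDl (_ : _ + _ = 0) ?scale0r//.
  by rewrite /GRing.scale/=; field; rewrite gt_eqF.
- rewrite mulmxBl mul1mx -scalemxAl -mulmxA.
  rewrite [u^T *m w]mx11_scalar mul_mx_scalar uw scalerA.
  rewrite (_ : 2 / s * _ = 1) ?scale1r ?subKr//.
  by field; rewrite gt_eqF.
Qed.

Lemma orthogonal_trmx d (Q : 'M[R]_d) : orthogonal_mx Q -> Q^T *m Q = 1%:M.
Proof. exact: mulmx1C. Qed.

(** Deflation: a reflection carries a unit eigenvector to the first basis vector, which splits off a
    1 x 1 block; induction diagonalizes the remaining symmetric block. *)
Theorem symmetric_spectral d (A : 'M[R]_d) : A^T = A ->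
  exists Q (l : 'rV[R]_d), orthogonal_mx Q /\ A = Q *m diag_mx l *m Q^T.
Proof.
elim: d A => [A _|d IH A symA].
  by exists 1%:M, 0; split; apply/matrixP => -[].
have [a /eigenvalueP[v0 v0A v0_neq0]] := symmetric_eigenvalue symA.
pose s : R := (v0^T^T *m v0^T) 0 0.
have s_gt0 : 0 < s by rewrite sqr_col_gt0 ?trmx_eq0.
pose v := (Num.sqrt s)^-1 *: v0^T.
have Av : A *m v = a *: v.
  by rewrite -scalemxAr -{1}symA -trmx_mul v0A linearZ/= !scalerA mulrC.
pose e : 'cV[R]_(1 + d) := delta_mx 0 0.
have ve : v^T *m v = e^T *m e.
  rewrite /v linearZ/= linearZ/= -scalemxAl [_ *m v0^T]mx11_scalar -/s.
  rewrite scalerA -invfM -expr2 sqr_sqrtr ?ltW//.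
  rewrite scale_scalar_mx mulVf ?gt_eqF//.
  by rewrite trmx_delta mul_delta_mx; apply/matrixP=> i j; rewrite !ord1 !mxE.
have [H [HT HH He]] := @orthogonal_swap (1 + d) v e ve.
have [B [symB Be AE]] : exists B : 'M[R]_(1 + d),
    [/\ B^T = B, B *m e = a *: e & A = H *m B *m H].
  exists (H *m A *m H); split.
  - by rewrite !trmx_mul HT symA mulmxA.
  - by rewrite -mulmxA He -mulmxA Av -scalemxAr -He mulmxA HH mul1mx.
  - by rewrite !mulmxA HH mul1mx -mulmxA HH mulmx1.
(* The eigenvector equation determines the first column; symmetry then clears the first row. *)
have BE : B = block_mx a%:M 0 0 (drsubmx B).
  have dl0 : dlsubmx B = 0.
    apply/colP => i; rewrite !mxE.
    have /matrixP/(_ (rshift 1 i) 0) := Be; rewrite -colE !mxE/= mulr0.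
    by move=> <-; congr (B _ _); apply/val_inj.
  rewrite -[LHS]submxK dl0; congr (block_mx _ _ _ _).
    apply/matrixP => i j; rewrite !ord1 !mxE.
    have /matrixP/(_ 0 0) := Be; rewrite -colE !mxE/= mulr1 => <-.
    by congr (B _ _); apply/val_inj.
  by rewrite -[RHS]trmx0 -dl0 trmx_dlsub symB.
have [|Q [l [orthQ QlE]]] := IH (drsubmx B).
  by rewrite trmx_drsub symB.
pose Q1 : 'M[R]_(1 + d) := block_mx 1%:M 0 0 Q.
(* The dimension is displayed as [1 + d] so that block matrices typecheck. *)
change (exists (Q : 'M[R]_(1 + d)) (l : 'rV[R]_(1 + d)),
  orthogonal_mx Q /\ A = Q *m diag_mx l *m Q^T).
exists (H *m Q1), (row_mx a%:M l); split.
  rewrite /orthogonal_mx trmx_mul mulmxA -[H *m Q1 *m _]mulmxA.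
  rewrite /Q1 tr_block_mx mulmx_block !trmx0 trmx1.
  rewrite !(mulmx0, mul0mx, mulmx1, mul1mx, addr0, add0r) orthQ.
  by rewrite -scalar_mx_block mulmx1 HT.
rewrite AE trmx_mul HT !mulmxA; congr (_ *m _).
rewrite -!mulmxA; congr (_ *m _).
rewrite {1}BE diag_mx_row /Q1 tr_block_mx !mulmx_block !trmx0 trmx1.
rewrite !(mulmx0, mul0mx, mulmx1, mul1mx, addr0, add0r) -mulmxA in QlE *.
rewrite QlE; congr (block_mx _ _ _ _).
by apply/matrixP => i j; rewrite !ord1 !mxE eqxx !mulr1n.
Qed.

End spectral.

(** * Functional calculus *)

Section functional_calculus.
Context {R : realType} {d : nat}.
Implicit Types (A B Q : 'M[R]_d) (v : 'cV[R]_d) (f g : R -> R).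

(** Two diagonalizations are linked by W = Q^T Q', which intertwines the diagonal matrices: l_i W_ij
    = W_ij l'_j. A nonzero W_ij forces l_i = l'_j, so W also intertwines their images under [f]. *)
Lemma mx_applyE f Q (l : 'rV[R]_d) : orthogonal_mx Q ->
  mx_apply f (Q *m diag_mx l *m Q^T) = Q *m diag_mx (map_mx f l) *m Q^T.
Proof.
move=> orthQ; rewrite /mx_apply; case: xgetP => [B _|/(_ _)/= noB]; last first.
  by exfalso; apply: (noB (Q *m diag_mx (map_mx f l) *m Q^T)); exists Q, l.
move=> [Q' [l' [orthQ' QQ' ->]]].
pose W := Q^T *m Q'.
have WE : diag_mx l *m W = W *m diag_mx l'.
  have := congr1 (fun M => Q^T *m M *m Q') QQ'.
  rewrite /= !mulmxA orthogonal_trmx// mul1mx -!mulmxA.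
  by rewrite orthogonal_trmx// mulmx1.
have fWE : diag_mx (map_mx f l) *m W = W *m diag_mx (map_mx f l').
  clearbody W; apply/matrixP => i j; move/matrixP/(_ i j) : WE.
  rewrite !mul_diag_mx !mul_mx_diag !mxE.
  have [->|w0] := eqVneq (W i j) 0; first by rewrite !mulr0 !mul0r.
  by rewrite [W i j * _]mulrC => /(mulIf w0) ->; rewrite mulrC.
transitivity (Q *m (W *m diag_mx (map_mx f l')) *m Q'^T).
  by rewrite /W !mulmxA orthQ mul1mx.
by rewrite -fWE /W -!mulmxA orthQ' mulmx1.
Qed.

(** The default value of [xget] matters because measurability of [mx_apply f] is proved on all
    matrices. *)
Lemma mx_apply_nonsym f A : A \isn't symmetricmx -> mx_apply f A = 0.
Proof.
move=> nsymA; rewrite /mx_apply; case: xgetP => // B _ [Q [l [_ AE _]]].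
case/symmetricmxP: nsymA.
by rewrite AE !trmx_mul trmxK tr_diag_mx mulmxA.
Qed.

Lemma mx_apply_comp f g A : A \is symmetricmx ->
  mx_apply f (mx_apply g A) = mx_apply (f \o g) A.
Proof.
move=> /symmetricmxP/symmetric_spectral[Q [l [orthQ ->]]].
rewrite !mx_applyE//; congr (_ *m diag_mx _ *m _).
by apply/rowP => i; rewrite !mxE.
Qed.

Lemma mx_apply_sym f A : mx_apply f A \is symmetricmx.
Proof.
have [|/mx_apply_nonsym ->] := boolP (A \is symmetricmx); last first.
  by apply/symmetricmxP; rewrite trmx0.
move=> /symmetricmxP/symmetric_spectral[Q [l [orthQ ->]]].
rewrite mx_applyE//; apply/symmetricmxP.
by rewrite !trmx_mul trmxK tr_diag_mx mulmxA.
Qed.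

Lemma mx_apply_tr f A : (mx_apply f A)^T = mx_apply f A.
Proof. exact/symmetricmxP/mx_apply_sym. Qed.

Lemma quad_diag (l : 'rV[R]_d) v :
  (v^T *m diag_mx l *m v) 0 0 = \sum_i l 0 i * v i 0 ^+ 2.
Proof.
rewrite -mulmxA mul_diag_mx !mxE; apply: eq_bigr => i _.
by rewrite !mxE; ring.
Qed.

Lemma quad_conj m (B : 'M[R]_(d, m)) A (v : 'cV[R]_m) :
  v^T *m (B^T *m A *m B) *m v = (B *m v)^T *m A *m (B *m v).
Proof. by rewrite trmx_mul !mulmxA. Qed.

Lemma psd_conj m (B : 'M[R]_(d, m)) A : psd_mx A -> psd_mx (B^T *m A *m B).
Proof.
move=> [/symmetricmxP symA A0]; split.
  by apply/symmetricmxP; rewrite !trmx_mul symA trmxK mulmxA.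
by move=> v; rewrite quad_conj.
Qed.

Lemma psd_diag (l : 'rV[R]_d) : (forall i, 0 <= l 0 i) -> psd_mx (diag_mx l).
Proof.
move=> l0; split; first by apply/symmetricmxP; rewrite tr_diag_mx.
by move=> v; rewrite quad_diag sumr_ge0// => i _; rewrite mulr_ge0// sqr_ge0.
Qed.

Lemma psd_apply f A : A \is symmetricmx -> (forall x, 0 <= f x) ->
  psd_mx (mx_apply f A).
Proof.
move=> /symmetricmxP/symmetric_spectral[Q [l [orthQ ->]]] f0.
rewrite mx_applyE// -[Q in X in psd_mx X]trmxK [Q^T^T^T]trmxK.
by apply/psd_conj/psd_diag => i; rewrite mxE.
Qed.

Lemma orthogonal_col Q i : orthogonal_mx Q -> Q^T *m col i Q = delta_mx i 0.
Proof.
by move=> /orthogonal_trmx QQ; rewrite colE mulmxA QQ mul1mx.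
Qed.

Lemma orthogonal_col_neq0 Q i : orthogonal_mx Q -> col i Q != 0.
Proof.
move=> orthQ; apply/eqP => Q0.
have : Q^T *m col i Q = delta_mx i 0 by exact: orthogonal_col.
rewrite Q0 mulmx0 => /colP/(_ i); rewrite !mxE !eqxx => /eqP.
by rewrite eq_sym oner_eq0.
Qed.

Lemma spectral_col Q (l : 'rV[R]_d) i : orthogonal_mx Q ->
  Q *m diag_mx l *m Q^T *m col i Q = l 0 i *: col i Q.
Proof.
move=> orthQ; rewrite -mulmxA orthogonal_col// -mulmxA colE scalemxAr.
congr (_ *m _); apply/colP => k; rewrite mul_diag_mx !mxE andbT.
by case: eqVneq => [->//|_]; rewrite !mulr0.
Qed.

Lemma quad_spectral Q (l : 'rV[R]_d) i : orthogonal_mx Q ->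
  ((col i Q)^T *m (Q *m diag_mx l *m Q^T) *m col i Q) 0 0 =
  l 0 i * ((col i Q)^T *m col i Q) 0 0.
Proof.
by move=> orthQ; rewrite -mulmxA spectral_col// -scalemxAr mxE.
Qed.

Lemma psd_eigen_ge0 Q (l : 'rV[R]_d) i : orthogonal_mx Q ->
  psd_mx (Q *m diag_mx l *m Q^T) -> 0 <= l 0 i.
Proof.
move=> orthQ [_ /(_ (col i Q))]; rewrite quad_spectral//.
by rewrite pmulr_lge0// sqr_col_gt0// orthogonal_col_neq0.
Qed.

Lemma pd_eigen_gt0 Q (l : 'rV[R]_d) i : orthogonal_mx Q ->
  pd_mx (Q *m diag_mx l *m Q^T) -> 0 < l 0 i.
Proof.
move=> orthQ [_ /(_ (col i Q))]; rewrite orthogonal_col_neq0// => /(_ isT).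
by rewrite quad_spectral// pmulr_lgt0// sqr_col_gt0// orthogonal_col_neq0.
Qed.

Lemma psd_spectral A : psd_mx A -> exists Q (l : 'rV[R]_d),
  [/\ orthogonal_mx Q, A = Q *m diag_mx l *m Q^T & forall i, 0 <= l 0 i].
Proof.
move=> psdA; have [/symmetricmxP/symmetric_spectral[Q [l [orthQ AE]]] _] :=
  psdA.
by exists Q, l; split=> // i; apply: (psd_eigen_ge0 _ orthQ); rewrite -AE.
Qed.

Lemma pd_spectral A : pd_mx A -> exists Q (l : 'rV[R]_d),
  [/\ orthogonal_mx Q, A = Q *m diag_mx l *m Q^T & forall i, 0 < l 0 i].
Proof.
move=> pdA; have [/symmetricmxP/symmetric_spectral[Q [l [orthQ AE]]] _] :=
  pdA.
by exists Q, l; split=> // i; apply: (pd_eigen_gt0 _ orthQ); rewrite -AE.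
Qed.

Lemma psd_apply_eq f g A : psd_mx A -> {in Num.nneg, f =1 g} ->
  mx_apply f A = mx_apply g A.
Proof.
move=> /psd_spectral[Q [l [orthQ -> l0]]] fg.
rewrite !mx_applyE//; congr (_ *m diag_mx _ *m _).
by apply/rowP => i; rewrite !mxE fg// nnegrE.
Qed.

Lemma psd_apply_id f A : psd_mx A -> {in Num.nneg, f =1 id} ->
  mx_apply f A = A.
Proof.
move=> /psd_spectral[Q [l [orthQ -> l0]]] fg.
rewrite !mx_applyE//; congr (_ *m diag_mx _ *m _).
by apply/rowP => i; rewrite !mxE fg// nnegrE.
Qed.

Lemma psd_mx0 : psd_mx (0 : 'M[R]_d).
Proof.
split; first by apply/symmetricmxP; rewrite trmx0.
by move=> v; rewrite mulmx0 mul0mx mxE.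
Qed.

Lemma psd_mx_abs B : psd_mx (mx_abs B).
Proof.
have [symB|nsymB] := boolP (B \is symmetricmx); first exact: psd_apply.
by rewrite /mx_abs mx_apply_nonsym//; exact: psd_mx0.
Qed.

Lemma psd_mx_pow A p : psd_mx A -> psd_mx (mx_pow A p).
Proof. by move=> [symA _]; apply: psd_apply => // x; exact: powR_ge0. Qed.

Lemma mx_powK A p : psd_mx A -> 0 < p -> mx_pow (mx_pow A p^-1) p = A.
Proof.
move=> psdA p0; have [symA _] := psdA; rewrite /mx_pow mx_apply_comp//.
apply: psd_apply_id => // x x0.
by rewrite /= -powRrM mulVf ?gt_eqF// powRr1.
Qed.

Lemma mx_pow_tr A p : (mx_pow A p)^T = mx_pow A p.
Proof. exact: mx_apply_tr. Qed.

Lemma mx_pow_pdD A p q : pd_mx A ->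
  mx_pow A (p + q) = mx_pow A p *m mx_pow A q.
Proof.
move=> /pd_spectral[Q [l [orthQ -> l0]]].
rewrite /mx_pow !mx_applyE// !mulmxA; congr (_ *m _).
rewrite -[_ *m Q^T *m Q]mulmxA orthogonal_trmx// mulmx1 -mulmxA mulmx_diag.
congr (_ *m diag_mx _); apply/rowP => i; rewrite !mxE.
by rewrite powRD// (gt_eqF (l0 i)) implybT.
Qed.

Lemma mx_pow_pd0 A : pd_mx A -> mx_pow A 0 = 1%:M.
Proof.
move=> /pd_spectral[Q [l [orthQ -> l0]]].
rewrite /mx_pow !mx_applyE// (_ : map_mx _ _ = const_mx 1).
  by rewrite diag_const_mx mulmx1.
by apply/rowP => i; rewrite !mxE powRr0.
Qed.

Lemma mx_pow_pd1 A : pd_mx A -> mx_pow A 1 = A.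
Proof.
move=> /pd_spectral[Q [l [orthQ -> l0]]].
rewrite /mx_pow !mx_applyE//; congr (_ *m diag_mx _ *m _).
by apply/rowP => i; rewrite !mxE powRr1// ltW.
Qed.

End functional_calculus.

(** * Loewner-Heinz inequality *)

Section loewner_heinz.
Context {R : realType} {d : nat}.
Implicit Types (A B Q : 'M[R]_d) (v : 'cV[R]_d).

Lemma loewner_conj m (C : 'M[R]_(d, m)) A B :
  loewner_le A B -> loewner_le (C^T *m A *m C) (C^T *m B *m C).
Proof. by move=> /(psd_conj C); rewrite mulmxBr mulmxBl. Qed.

(** A one-parameter group of symmetric matrices. These laws abstract the powers of a positive
    definite matrix and suffice for the midpoint argument below. *)
Definition sym_group (a : R -> 'M[R]_d) :=
  [/\ a 0 = 1%:M, forall p q, a (p + q) = a p *m a q & forall p, (a p)^T = a p].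

(** Conjugating the hypothesis by b(-p/2) gives C^T C <= 1 for C = a(p/2) b(-p/2). *)
Lemma sym_group_contraction a b p v : sym_group a -> sym_group b ->
  loewner_le (a p) (b p) ->
  let w := a (p / 2) *m b (- (p / 2)) *m v in
  (w^T *m w) 0 0 <= (v^T *m v) 0 0.
Proof.
move=> [a0 aD aT] [b0 bD bT] /(loewner_conj (b (- (p / 2)))) [_ /(_ v)].
rewrite mulmxBr mulmxBl bT.
have -> : b (- (p / 2)) *m b p *m b (- (p / 2)) = 1%:M.
  by rewrite -!bD -b0; congr b; field.
have -> : a p = a (p / 2) *m a (p / 2) by rewrite -aD -splitr.
rewrite mulmx1 mxE [X in _ + X]mxE subr_ge0; apply: le_trans.
by rewrite !trmx_mul aT bT !mulmxA.
Qed.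

(** In an orthonormal eigenbasis the order against the identity is a bound on eigenvalues, which,
    unlike the order itself, is invariant under similarity. *)
Lemma loewner_le1 A : A \is symmetricmx ->
  (forall v a, v != 0 -> A *m v = a *: v -> a <= 1) -> loewner_le A 1%:M.
Proof.
move=> /symmetricmxP/symmetric_spectral[Q [l [orthQ ->]]] le1.
rewrite /loewner_le -[X in X - _]orthQ -{1}[Q]mulmx1 -mulmxBl -mulmxBr.
rewrite -{1}[Q]trmxK -diag_const_mx -linearB/=; apply/psd_conj/psd_diag => i.
rewrite !mxE subr_ge0; apply: le1 (spectral_col l i orthQ).
exact: orthogonal_col_neq0.
Qed.

(* Pedersen's argument: [b(-r) a(2r) b(-r)], [r = (p + q) / 4], is similar to
   the product of the contractions [b(-p/2) a(p/2)] and [a(q/2) b(-q/2)],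
   hence its eigenvalues are at most 1. *)
Lemma sym_group_mid a b p q : sym_group a -> sym_group b ->
  loewner_le (a p) (b p) -> loewner_le (a q) (b q) ->
  loewner_le (a ((p + q) / 2)) (b ((p + q) / 2)).
Proof.
move=> ga gb lep leq; have [a0 aD aT] := ga; have [b0 bD bT] := gb.
have bV r : b r *m b (- r) = 1%:M by rewrite -bD subrr b0.
have bV' r : b (- r) *m b r = 1%:M by rewrite -bD addNr b0.
pose r := (p + q) / 4; pose M := b (- r) *m a ((p + q) / 2) *m b (- r).
have symM : M \is symmetricmx.
  by apply/symmetricmxP; rewrite !trmx_mul !bT aT mulmxA.
have : loewner_le M 1%:M.
  (* The shift [s] satisfies s - r = -p/2 and s - q/2 = -r, so [b s] intertwines [M] with the
     product of the two contractions. *)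
  apply: loewner_le1 => // v x v0 Mv; pose s := (q - p) / 4.
  pose u := b s *m v.
  have u0 : u != 0.
    apply: contraNneq v0 => u0; have := congr1 (mulmx (b (- s))) u0.
    by rewrite mulmxA bV' mul1mx mulmx0 => ->.
  pose Cp := a (p / 2) *m b (- (p / 2)); pose Cq := a (q / 2) *m b (- (q / 2)).
  have CS : Cp^T *m Cq *m b s = b s *m M.
    rewrite /M /Cp /Cq trmx_mul bT aT !mulmxA -bD.
    rewrite -[_ *m b _ *m b s]mulmxA -bD -[_ *m a _ *m a _]mulmxA -aD.
    by congr (b _ *m a _ *m b _); rewrite /r /s; field.
  have Nu : Cp^T *m Cq *m u = x *: u.
    by rewrite /u mulmxA CS -mulmxA Mv -scalemxAr.
  have := sym_group_contraction u ga gb leq.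
  have := sym_group_contraction u ga gb lep.
  rewrite /= -/Cp -/Cq => lep1 leq1; clearbody u Cp Cq.
  (* The left side is the inner product of Cp u and Cq u, at most half the sum of their squared
     norms, each bounded by that of [u]. *)
  have : x * (u^T *m u) 0 0 <= (u^T *m u) 0 0.
    have -> : x * (u^T *m u) 0 0 = ((Cp *m u)^T *m (Cq *m u)) 0 0.
      by rewrite trmx_mul -mulmxA [Cp^T *m _]mulmxA Nu -scalemxAr [RHS]mxE.
    move: lep1 leq1; move: (Cp *m u) (Cq *m u) => y z.
    have := sqr_col_ge0 (y - z).
    have -> : ((y - z)^T *m (y - z)) 0 0 =
        (y^T *m y) 0 0 + (z^T *m z) 0 0 - 2 * (y^T *m z) 0 0.
      rewrite !mxE mulr_sumr -big_split/= -sumrB; apply: eq_bigr => i _.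
      by rewrite !mxE; ring.
    move: ((y^T *m y) 0 0 : R) ((z^T *m z) 0 0 : R) ((y^T *m z) 0 0 : R).
    by move=> yy zz yz ? ? ?; lra.
  by rewrite -[leRHS]mul1r ler_pM2r// sqr_col_gt0.
move=> /(loewner_conj (b r)); rewrite bT mulmx1 -bD /M !mulmxA bV mul1mx.
by rewrite -mulmxA bV' mulmx1 (_ : r + r = (p + q) / 2)// /r; field.
Qed.

Lemma mx_pow_sym_group A : pd_mx A -> sym_group (mx_pow A).
Proof.
move=> pdA; split; [exact: mx_pow_pd0 | | exact: mx_pow_tr].
by move=> p q; exact: mx_pow_pdD.
Qed.

(** Bisection keeps [p] between two points of [S] at distance 2^-n. *)
Lemma midpoint_dense (S : set R) : S 0 -> S 1 ->
  (forall x y, S x -> S y -> S ((x + y) / 2)) ->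
  forall p e, 0 <= p <= 1 -> 0 < e -> exists2 x, S x & `|p - x| < e.
Proof.
move=> S0 S1 Smid p e p01 e0.
have bisect n : exists x y, [/\ S x, S y, x <= p <= y & y - x = 2^-1 ^+ n].
  elim: n => [|n [x [y [Sx Sy xpy xyE]]]].
    by exists 0, 1; split=> //; rewrite subr0.
  have [pm|mp] := leP p ((x + y) / 2).
    exists x, ((x + y) / 2); split; [by []|exact: Smid| |].
      by rewrite pm andbT; case/andP: xpy.
    by rewrite exprS -xyE; field.
  exists ((x + y) / 2), y; split; [exact: Smid|by []| |].
    by rewrite (ltW mp); case/andP: xpy.
  by rewrite exprS -xyE; field.
have /cvgrPdist_lt/(_ _ e0)[n _ /(_ n (leqnn n))] :
    (fun n => (2^-1 : R) ^+ n) @ \oo --> (0 : R).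
  by apply: cvg_expr; rewrite gtr0_norm// invf_lt1// ltr1n.
have [x [y [Sx Sy xpy <-]]] := bisect n.
case/andP: xpy => xp py; rewrite sub0r normrN ger0_norm; last by lra.
by move=> xye; exists x => //; rewrite ger0_norm; lra.
Qed.

(** Reduces limits of quadratic forms to limits of scalar functions of the eigenvalues. *)
Lemma quad_spectral_apply f Q (l : 'rV[R]_d) v : orthogonal_mx Q ->
  (v^T *m mx_apply f (Q *m diag_mx l *m Q^T) *m v) 0 0 =
  \sum_i f (l 0 i) * (Q^T *m v) i 0 ^+ 2.
Proof.
move=> orthQ; rewrite mx_applyE// !mulmxA -[_ *m Q^T *m v]mulmxA.
rewrite -[v^T *m Q]trmxK trmx_mul trmxK quad_diag.
by apply: eq_bigr => i _; rewrite mxE.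
Qed.

Lemma continuous_sum (I : Type) (s : seq I) (T : topologicalType)
    (F : I -> T -> R) (x : T) :
  (forall i, {for x, continuous (F i)}) ->
  {for x, continuous (fun y => \sum_(i <- s) F i y)}.
Proof.
by move=> Fc; apply: cvg_big => [|i _]; [exact: add_continuous|exact: Fc].
Qed.

Lemma powR_continuous_exponent (x : R) : 0 < x -> continuous (fun p => x `^ p).
Proof.
move=> x0; rewrite (_ : (fun p => _) = expR \o (fun p => p * ln x)).
  move=> p; apply: continuous_comp; last exact: continuous_expR.
  exact: mulrr_continuous.
by apply/funext => p; rewrite /= /powR gt_eqF.
Qed.

Lemma quad_pow_continuous A v : pd_mx A ->
  continuous (fun p => (v^T *m mx_pow A p *m v) 0 0).
Proof.
move=> /pd_spectral[Q [l [orthQ -> l0]]] p.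
rewrite (_ : (fun p => _) =
    fun p => \sum_i (l 0 i) `^ p * (Q^T *m v) i 0 ^+ 2).
  apply: continuous_sum => i; apply: cvgMl; exact: powR_continuous_exponent.
by apply/funext => ?; rewrite quad_spectral_apply.
Qed.

(** The exponents for which the inequality holds contain 0 and 1 and are stable under midpoints,
    hence are dense in [0, 1]. A failure at [q] for some vector would, by continuity in the
    exponent, persist at one of them. *)
Lemma loewner_heinz_pd A B q : pd_mx A -> pd_mx B -> 0 <= q <= 1 ->
  loewner_le A B -> loewner_le (mx_pow A q) (mx_pow B q).
Proof.
move=> pdA pdB q01 AB; split.
  by apply/symmetricmxP; rewrite linearB/= !mx_pow_tr.
move=> v; rewrite leNgt; apply/negP => neg.
pose g p := (v^T *m (mx_pow B p - mx_pow A p) *m v) 0 0.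
have gc : continuous g.
  rewrite (_ : g = fun p => (v^T *m mx_pow B p *m v) 0 0 -
                            (v^T *m mx_pow A p *m v) 0 0).
    by move=> p; apply: cvgB; exact: quad_pow_continuous.
  by apply/funext => p; rewrite /g mulmxBr mulmxBl !mxE.
have /cvgr_lt/(_ _ neg) := gc q.
move=> /nbhs_ballP[e /= e0 ge].
have [|||p lep qp] := @midpoint_dense
   [set p | loewner_le (mx_pow A p) (mx_pow B p)] _ _ _ q e q01 e0.
- rewrite /= !mx_pow_pd0// /loewner_le subrr.
  split; first by apply/symmetricmxP; rewrite trmx0.
  by move=> w; rewrite mulmx0 mul0mx mxE.
- by rewrite /= !mx_pow_pd1.
- by move=> x y; apply: sym_group_mid; exact: mx_pow_sym_group.
- by have := ge p qp; rewrite ltNge => /negP; apply; case: lep => _; exact.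
Qed.

Lemma pd_add_scalar A e : psd_mx A -> 0 < e -> pd_mx (A + e%:M).
Proof.
move=> [/symmetricmxP symA A0] e0; split.
  by apply/symmetricmxP; rewrite linearD/= tr_scalar_mx symA.
move=> v v0; rewrite mulmxDr mulmxDl mxE ltr_wpDl//.
by rewrite mul_mx_scalar -scalemxAl mxE mulr_gt0// sqr_col_gt0.
Qed.

Lemma spectral_add_scalar Q (l : 'rV[R]_d) e : orthogonal_mx Q ->
  Q *m diag_mx l *m Q^T + e%:M = Q *m diag_mx (l + const_mx e) *m Q^T.
Proof.
move=> orthQ; rewrite linearD/= mulmxDr mulmxDl diag_const_mx.
by rewrite mul_mx_scalar -scalemxAl orthQ scalemx1.
Qed.

(** Away from 0 this is exp(q ln |x|); at 0 that formula breaks down, and q > 0 is what gives the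
    limit 0. *)
Lemma normr_powR_continuous (q : R) :
  0 < q -> continuous (fun x : R => `|x| `^ q).
Proof.
move=> q0 x; have [->|x0] := eqVneq x 0.
  rewrite /continuous_at normr0 powR0 ?gt_eqF//; apply/cvgrPdist_lt => /= e e0.
  near=> y; rewrite sub0r normrN ger0_norm ?powR_ge0//.
  (* Writing [e] as (e^(1/q))^q shows that the radius e^(1/q) works. *)
  rewrite -[ltRHS](@powRr1 R e) ?ltW// -(mulVf (lt0r_neq0 q0)) powRrM.
  apply: gt0_ltr_powR; rewrite ?nnegrE ?powR_ge0//.
  near: y; exists (e `^ q^-1); first exact: powR_gt0.
  by move=> z /=; rewrite sub0r normrN.
apply: (@cvg_trans _ (expR (q * ln `|y|) @[y --> x])).
  apply: near_eq_cvg; near=> y; rewrite /powR gt_eqF ?normr_gt0//.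
  near: y; exact: (cvgr_neq0 x).
rewrite /powR gt_eqF ?normr_gt0//.
apply: (@continuous_comp _ _ _ (fun y => q * ln `|y|) expR); last first.
  exact: continuous_expR.
apply: cvgMr; apply: (@continuous_comp _ _ _ (fun y : R => `|y|) (@ln R)).
  exact: norm_continuous.
by apply: continuous_ln; rewrite normr_gt0.
Unshelve. all: by end_near. Qed.

Lemma quad_pow_add_scalar_cvg A v q : psd_mx A -> 0 < q ->
  (v^T *m mx_pow (A + e%:M) q *m v) 0 0 @[e --> 0^'+] -->
  (v^T *m mx_pow A q *m v) 0 0.
Proof.
move=> /psd_spectral[Q [l [orthQ -> l0]]] q0.
rewrite [X in _ --> X]quad_spectral_apply//.
under eq_fun do rewrite spectral_add_scalar// quad_spectral_apply//.
apply: cvg_big => [|i _]; first exact: add_continuous.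
apply: cvgMl.
(* For e > 0 the shifted eigenvalue is nonnegative, so the absolute value changes nothing, and it
   supplies continuity even when the eigenvalue is 0. *)
apply: (@cvg_trans _ (`|l 0 i + e| `^ q @[e --> 0^'+])).
  apply: near_eq_cvg; near=> e; rewrite !mxE ger0_norm// addr_ge0//.
apply: cvg_at_right_filter.
rewrite -[in X in _ --> X](ger0_norm (l0 i)) -[in X in _ --> X](addr0 (l 0 i)).
apply: (@continuous_comp _ _ _ (fun e => l 0 i + e) (fun x => `|x| `^ q)).
  by apply: cvgD; [exact: cvg_cst|exact: cvg_id].
exact: normr_powR_continuous.
Unshelve. all: by end_near. Qed.

(** Adding e times the identity to both sides makes them positive definite and keeps the order; the
    inequality survives the limit as e decreases to 0. *)
Theorem loewner_heinz A B q : psd_mx A -> psd_mx B -> 0 < q <= 1 ->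
  loewner_le A B -> loewner_le (mx_pow A q) (mx_pow B q).
Proof.
move=> psdA psdB /andP[q0 q1] AB; split.
  by apply/symmetricmxP; rewrite linearB/= !mx_pow_tr.
move=> v; rewrite mulmxBr mulmxBl mxE [X in _ + X]mxE.
have Acvg := @quad_pow_add_scalar_cvg A v q psdA q0.
have Bcvg := @quad_pow_add_scalar_cvg B v q psdB q0.
apply: (cvgr_to_ge (cvgB Bcvg Acvg)); near=> e.
have e0 : 0 < e by near: e; exact: nbhs_right_gt.
have [] := @loewner_heinz_pd (A + e%:M) (B + e%:M) q.
- exact: pd_add_scalar.
- exact: pd_add_scalar.
- by rewrite ltW ?q0.
- by rewrite /loewner_le opprD addrACA subrr addr0.
- by move=> _ /(_ v); rewrite mulmxBr mulmxBl mxE [X in _ + X]mxE.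
Unshelve. all: by end_near. Qed.

End loewner_heinz.

(** * Borel measurability *)

Section matrix_continuity.
Context {R : realType} {T : topologicalType}.

Lemma continuous_mx m n (F : T -> 'M[R]_(m, n)) :
  (forall i j, continuous (fun x => F x i j)) -> continuous F.
Proof.
move=> Fc x B [S S_nbhs SB]; apply: (filterS (fun y Sy => SB _ Sy)).
apply: filter_forall => i; apply: filter_forall => j; exact: Fc (S_nbhs i j).
Qed.

Lemma continuous_mx_coord m n (F : T -> 'M[R]_(m, n)) i j :
  continuous F -> continuous (fun x => F x i j).
Proof.
move=> Fc x; apply: (@continuous_comp _ _ _ F (fun M : 'M[R]_(m, n) => M i j)).
  exact: Fc.
exact: coord_continuous.
Qed.

Lemma continuous_mulmx m n p (F : T -> 'M[R]_(m, n)) (G : T -> 'M[R]_(n, p)) :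
  continuous F -> continuous G -> continuous (fun x => F x *m G x).
Proof.
move=> Fc Gc; apply: continuous_mx => i j x.
rewrite (_ : (fun x => _) = fun x => \sum_k F x i k * G x k j); last first.
  by apply/funext => y; rewrite mxE.
apply: cvg_big => [|k _]; first exact: add_continuous.
by apply: cvgM; exact: continuous_mx_coord.
Qed.

Lemma continuous_trmx m n (F : T -> 'M[R]_(m, n)) :
  continuous F -> continuous (fun x => (F x)^T).
Proof.
move=> Fc; apply: continuous_mx => i j x.
rewrite (_ : (fun x => _) = fun x => F x j i); first exact: continuous_mx_coord.
by apply/funext => y; rewrite mxE.
Qed.

End matrix_continuity.

Section borel_matrices.
Context {R : realType} {d : nat}.

Lemma closed_measurable_mx (C : set 'M[R]_d) :
  closed C -> measurable (C : set (borel_mx R d)).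
Proof.
move=> clC; rewrite -[C]setCK; apply: measurableC.
by apply: sub_sigma_algebra; rewrite /= openC.
Qed.

(** Closed sets are used as generators since they intersect compact sets in compact sets, whose
    continuous images are again closed. *)
Lemma measurable_fun_mx_closed dT (T : measurableType dT)
    (F : T -> borel_mx R d) :
  (forall C : set 'M[R]_d, closed C -> measurable (F @^-1` C)) ->
  measurable_fun setT F.
Proof.
move=> FC; apply: (@measurability _ _ _ (borel_mx R d) setT F (@open 'M[R]_d))
  => //.
move=> _ [B openB <-].
rewrite setTI -[B]setCK preimage_setC; apply: measurableC.
by apply: (FC (~` B)); exact: open_closedC.
Qed.

Lemma continuous_measurable_mx (F : 'M[R]_d -> 'M[R]_d) : continuous F ->
  measurable_fun [set: borel_mx R d] (F : borel_mx R d -> borel_mx R d).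
Proof.
move=> Fc; apply: measurable_fun_mx_closed => C clC.
apply: closed_measurable_mx; apply: preimage_closed => // x _; exact: Fc.
Qed.

Lemma measurable_mx_coord dT (T : measurableType dT)
    (F : T -> borel_mx R d) i j :
  measurable_fun setT F -> measurable_fun setT (fun w => (F w : 'M[R]_d) i j).
Proof.
move=> mF; apply: (@measurableT_comp _ _ _ _ _ _
  (fun M : borel_mx R d => (M : 'M[R]_d) i j)) => //.
apply: (measurability _ (RGenOInfty.measurableE R)).
move=> _ [_ [a ->] <-].
rewrite setTI; apply: sub_sigma_algebra; apply: open_comp => [M _|].
  exact: coord_continuous.
exact: interval_open.
Qed.

Lemma measurable_fun_sumr dT (T : measurableType dT) (I : Type) (s : seq I)
    (F : I -> T -> R) : (forall i, measurable_fun setT (F i)) ->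
  measurable_fun setT (fun w => \sum_(i <- s) F i w).
Proof.
move=> mF; elim: s => [|i s IH].
  by under eq_fun do rewrite big_nil; exact: measurable_cst.
by under eq_fun do rewrite big_cons; exact: measurable_funD.
Qed.

Lemma measurable_mulmx dT (T : measurableType dT) m n p
    (F : T -> 'M[R]_(m, n)) (G : T -> 'M[R]_(n, p)) :
  (forall i j, measurable_fun setT (fun w => F w i j)) ->
  (forall i j, measurable_fun setT (fun w => G w i j)) ->
  forall i j, measurable_fun setT (fun w => (F w *m G w) i j).
Proof.
move=> mF mG i j; under eq_fun do rewrite mxE.
by apply: measurable_fun_sumr => k; exact: measurable_funM.
Qed.

Lemma quad_continuous (A : 'M[R]_d) :
  continuous (fun v : 'cV[R]_d => (v^T *m A *m v) 0 0).
Proof.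
have idc : continuous (fun v : 'cV[R]_d => v) by move=> v B.
have cAc : continuous (fun _ : 'cV[R]_d => A) by exact: cst_continuous.
apply: (continuous_mx_coord (F := fun v : 'cV[R]_d => v^T *m A *m v)).
exact: continuous_mulmx (continuous_mulmx (continuous_trmx idc) cAc) idc.
Qed.

(** Rational vectors are dense and the quadratic form is continuous. Positivity thus becomes a
    countable family of conditions, as measurability requires. *)
Lemma psd_mx_rat (A : 'M[R]_d) : psd_mx A <->
  A^T = A /\ forall r : 'cV[rat]_d,
    0 <= ((map_mx ratr r)^T *m A *m map_mx ratr r) 0 0.
Proof.
split=> [[/symmetricmxP symA A0]|[symA A0]]; first by split.
split; [exact/symmetricmxP|move=> v; rewrite leNgt; apply/negP => neg].
have /cvgr_lt/(_ _ neg) := @quad_continuous A v.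
move=> /nbhs_ballP[e /= e0 ve].
have /choice[r rv] : forall i, exists q : rat, ratr q \in `]v i 0, v i 0 + e[.
  by move=> i; apply: rat_in_itvoo; rewrite ltrDl.
have := A0 (\col_i r i); rewrite leNgt => /negP; apply.
apply: ve; split=> // i j; rewrite ord1 !mxE.
have := rv i; rewrite in_itv/= => /andP[lo hi].
by rewrite /ball/= distrC ger0_norm ?subr_ge0 ?ltW// ltrBlDl.
Qed.

Lemma measurable_psd_mx dT (T : measurableType dT) (F : T -> 'M[R]_d) :
  (forall i j, measurable_fun setT (fun w => F w i j)) ->
  measurable [set w | psd_mx (F w)].
Proof.
move=> mF.
(* Symmetry is a finite intersection. Positivity is a countable one, rational vectors being
   enumerated by [unpickle]; integers that encode no vector impose no condition. *)
pose S (ij : 'I_d * 'I_d) := [set w | F w ij.2 ij.1 == F w ij.1 ij.2].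
pose Q (n : nat) := [set w | if unpickle n is Some r then
  0 <= ((map_mx ratr r)^T *m F w *m map_mx ratr (r : 'cV[rat]_d)) 0 0
  else true].
have -> : [set w | psd_mx (F w)] =
    (\bigcap_(ij in setT) S ij) `&` \bigcap_n Q n.
  apply/seteqP; split=> [w /= /psd_mx_rat[symF F0]|w /= [SF QF]].
    split=> [ij _|n _]; rewrite /S /Q /=; first by rewrite -{1}symF mxE.
    by case: unpickle.
  apply/psd_mx_rat; split=> [|r].
    by apply/matrixP => i j; rewrite mxE; apply/eqP; exact: (SF (i, j)).
  by have := QF (pickle r) I; rewrite /Q /= pickleK.
apply: measurableI.
  apply: fin_bigcap_measurable => // ij _.
  rewrite -[X in measurable X]setTI; exact: (measurable_fun_eqr _ _ measurableT).
apply: bigcapT_measurable => n; rewrite /Q.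
case: unpickle => [r|]; last first.
  by rewrite (_ : [set _ | _] = setT) //; apply/seteqP.
rewrite -[X in measurable X]setTI.
apply: (measurable_fun_ler _ _ measurableT) => //.
by apply: measurable_mulmx => // i j; exact: measurable_mulmx.
Qed.

End borel_matrices.

(** * Borel measurability of the functional calculus *)

Section measurable_functional_calculus.
Context {R : realType} {d : nat}.

Lemma closed_symmetricmx : closed [set A : 'M[R]_d | A \is symmetricmx].
Proof.
rewrite (_ : [set A | _] = (fun A : 'M[R]_d => A^T - A) @^-1` [set 0]).
  apply: preimage_closed => [A _|]; last first.
    apply: accessible_closed_set1.
    exact: hausdorff_accessible (@norm_hausdorff _ _).
  apply: (continuous_mx (F := fun A : 'M[R]_d => A^T - A)) => i j {}A.
  rewrite (_ : (fun A : 'M[R]_d => _) = fun A => A j i - A i j).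
    exact: (cvgB (@coord_continuous R d d j i A)
                 (@coord_continuous R d d i j A)).
  by apply/funext => B; rewrite !mxE.
apply/seteqP; split=> A /= => [/symmetricmxP ->|A0]; first by rewrite subrr.
by apply/symmetricmxP/eqP; rewrite -subr_eq0 A0.
Qed.

(** The rows are unit vectors. This confines orthogonal matrices to a compact cube. *)
Lemma orthogonal_entry_le1 (Q : 'M[R]_d) i j : orthogonal_mx Q -> `|Q i j| <= 1.
Proof.
move=> orthQ; rewrite -(@expr_le1 _ 2)// real_normK ?num_real//.
have <- : (Q *m Q^T) i i = 1 by rewrite orthQ mxE eqxx.
rewrite mxE (bigD1 j)//= mxE -expr2 lerDl sumr_ge0// => k _.
by rewrite mxE -expr2 sqr_ge0.
Qed.

Local Notation param := ('rV[R]_(d * d) * 'rV[R]_d)%type.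

(** The matrix Q is flattened to a row so that compactness of cubes of row vectors applies; its
    orthogonality is imposed separately, as a closed condition. *)
Definition spectral_mx (g : R -> R) (p : param) : 'M[R]_d :=
  vec_mx p.1 *m diag_mx (map_mx g p.2) *m (vec_mx p.1)^T.

Lemma vec_mx_fst_continuous :
  continuous (fun p : param => vec_mx p.1 : 'M[R]_d).
Proof.
apply: continuous_mx => i j.
rewrite (_ : (fun p => _) = fun p : param => p.1 0 (mxvec_index i j)).
  by apply: continuous_mx_coord => p; exact: cvg_fst.
by apply/funext => p; rewrite !mxE.
Qed.

Lemma spectral_mx_continuous g : continuous g -> continuous (spectral_mx g).
Proof.
have vc := vec_mx_fst_continuous.
move=> gc; apply: continuous_mulmx (continuous_trmx vc).
apply: (continuous_mulmx vc); apply: continuous_mx => i j.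
rewrite (_ : (fun p => _) = fun p : param => g (p.2 0 i) *+ (i == j));
  last first.
  by apply/funext => p; rewrite !mxE.
case: (i == j); last exact: cst_continuous.
move=> p; apply: (@continuous_comp _ _ _ (fun p : param => p.2 0 i) g).
  by apply: continuous_mx_coord => {}p; exact: cvg_snd.
exact: gc.
Qed.

Lemma compact_param (n : nat) : compact [set p : param |
  (forall i, p.1 0 i \in `[-1, 1]) /\ (forall i, p.2 0 i \in `[- n%:R, n%:R])].
Proof.
pose cube m (a : R) := [set v : 'rV[R]_m | forall i, v ord0 i \in `[- a, a]].
have cubeK m a : compact (cube m a).
  apply: (@rV_compact _ _ (fun=> `[- a, a]%classic)) => _.
  exact: segment_compact.
exact: (compact_setX (cubeK (d * d)%N 1) (cubeK d n%:R)).
Qed.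

Lemma closed_orthogonal_param :
  closed [set p : param | orthogonal_mx (vec_mx p.1)].
Proof.
have vc := vec_mx_fst_continuous.
apply: (@preimage_closed _ _ (fun p : param => vec_mx p.1 *m (vec_mx p.1)^T)
  [set 1%:M]) => [p _|].
  exact: (continuous_mulmx vc (continuous_trmx vc)).
exact: accessible_closed_set1 (hausdorff_accessible (@norm_hausdorff _ _)) _.
Qed.

(* On symmetric matrices, the preimage of a closed set under [mx_apply f] is a
   countable union of continuous images of compact sets of pairs (Q, l). *)
Lemma measurable_mx_apply (f : R -> R) : continuous f ->
  measurable_fun [set: borel_mx R d]
    (mx_apply f : borel_mx R d -> borel_mx R d).
Proof.
move=> fc; apply: measurable_fun_mx_closed => C clC.
pose S := [set A : 'M[R]_d | A \is symmetricmx].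
have mS : measurable (S : set (borel_mx R d)).
  exact: closed_measurable_mx closed_symmetricmx.
pose K (n : nat) := [set p : param |
  (forall i, p.1 0 i \in `[-1, 1]) /\ (forall i, p.2 0 i \in `[- n%:R, n%:R])]
  `&` [set p : param | orthogonal_mx (vec_mx p.1)] `&` spectral_mx f @^-1` C.
(* Nonsymmetric matrices all go to 0, so they belong to the preimage all together or not at all,
   according to whether [C] contains 0. *)
have -> : mx_apply f @^-1` C =
    (\bigcup_n (spectral_mx id @` K n)) `|` (~` S `&` [set _ | C 0]).
  apply/seteqP; split=> A /=; last first.
    move=> [[n _ [p [[_ orthp] Cp] <-]]|[/negP nsymA C0]]; last first.
      by rewrite mx_apply_nonsym.
    by rewrite /spectral_mx map_mx_id// mx_applyE.
  move=> CA; have [symA|nsymA] := boolP (A \is symmetricmx); last first.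
    by right; split; [exact/negP|rewrite mx_apply_nonsym in CA].
  left; have [Q [l [orthQ AE]]] := symmetric_spectral (symmetricmxP _ symA).
  have [n ln] : exists n : nat, forall i, `|l 0 i| <= n%:R.
    exists (\max_i (Num.trunc `|l ord0 i|%R).+1)%N => i.
    apply/ltW/(lt_le_trans (truncnS_gt _)); rewrite ler_nat.
    exact: (leq_bigmax i).
  exists n => //; exists (mxvec Q, l); last first.
    by rewrite /spectral_mx mxvecK map_mx_id.
  have Q1 i : mxvec Q ord0 i \in `[-1, 1].
    rewrite in_itv/= -ler_norml; case/mxvec_indexP: i => i j.
    by rewrite mxvecE; exact: orthogonal_entry_le1.
  have l1 i : l ord0 i \in `[- n%:R, n%:R] by rewrite in_itv/= -ler_norml.
  split; first by split; [split|rewrite /= mxvecK].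
  by move: CA; rewrite AE mx_applyE// /spectral_mx/= mxvecK.
apply: measurableU; last first.
  apply: measurableI; first exact: measurableC.
  have [C0|nC0] := pselect (C 0).
    by rewrite (_ : [set _ | _] = setT)//; apply/seteqP; split.
  by rewrite (_ : [set _ | _] = set0)//; apply/seteqP; split.
apply: bigcupT_measurable => n; apply: closed_measurable_mx.
apply: compact_closed; first exact: norm_hausdorff.
apply: continuous_compact.
  apply: continuous_subspaceT; apply: spectral_mx_continuous => x.
  exact: cvg_id.
apply: compact_closedI; last first.
  by apply: preimage_closed => // p _; exact: spectral_mx_continuous.
apply: compact_closedI; [exact: compact_param|exact: closed_orthogonal_param].
Qed.

End measurable_functional_calculus.

(** * Independence and expectation *)

Section matrix_markov.
Context {R : realType} {disp : measure_display} {T : measurableType disp}.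
Context (P : probability T R).

(** Independence makes the joint law agree with the product of the marginals on rectangles, hence
    everywhere. The probability of [G] is then the integral of the probabilities of its sections. *)
Lemma independent_section_le d1 d2 (T1 : measurableType d1)
    (T2 : measurableType d2) (X : {RV P >-> T1}) (Y : {RV P >-> T2})
    (G : set (T1 * T2)) (g : T1 -> \bar R) :
  independent_RV X Y -> measurable G -> measurable_fun setT g ->
  (forall x, (P (Y @^-1` xsection G x) <= g x)%E) ->
  (P [set w | G (X w, Y w)] <= \int[P]_w g (X w))%E.
Proof.
move=> indXY mG mg Gg.
have mXY : measurable_fun setT (fun w => (X w, Y w)).
  by apply: measurable_fun_pair; exact: measurable_funPT.
pose XY : {mfun T >-> (T1 * T2)%type} :=
  HB.pack (fun w => (X w, Y w)) (isMeasurableFun.Build _ _ _ _ _ mXY).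
have g0 x : (0 <= g x)%E by apply: le_trans (Gg x); exact: measure_ge0.
have -> : P [set w | G (X w, Y w)] = (distribution P X \x distribution P Y)%E G.
  by rewrite (@product_measure_unique _ _ _ _ _ (distribution P X)
    (distribution P Y) (distribution P XY)).
rewrite -[leRHS](ge0_integral_distribution X)//.
apply: ge0_le_integral => //.
  exact: (measurable_fun_xsection (distribution P Y)).
by move=> x _; exact: Gg.
Qed.

(** The trace is a finite linear combination of entries. Integrability makes each expectation
    finite, so [fine] loses nothing. *)
Lemma integral_mxtrace_mul d (Y : T -> 'M[R]_d) (B : 'M[R]_d) :
  mx_integrable P Y ->
  (\int[P]_w (\tr (Y w *m B))%:E = (\tr (mx_expectation P Y *m B))%:E)%E.
Proof.
move=> intY.
have trE (M : 'M[R]_d) : \tr (M *m B) = \sum_i \sum_j M i j * B j i.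
  by rewrite /mxtrace; apply: eq_bigr => i _; rewrite mxE.
under eq_integral do rewrite trE pair_big/= -sumEFin.
rewrite integral_sum//= => [|[i j]]; last first.
  under eq_fun do rewrite mulrC EFinM.
  exact: integrableZl (intY i j).
rewrite trE pair_big/= -sumEFin; apply: eq_bigr => -[i j] _ /=.
under eq_integral do rewrite mulrC EFinM.
rewrite (integralZl measurableT (intY i j)) mulrC EFinM mxE; congr (_ * _)%E.
by rewrite unlock fineK//; exact: (integrable_fin_num measurableT (intY i j)).
Qed.

Section functional_calculus.
Context {d : nat}.
Implicit Types A B : 'M[R]_d.

Lemma measurable_mx_pow dT' (T' : measurableType dT')
    (F : T' -> borel_mx R d) p :
  0 < p -> (forall w, psd_mx (F w : 'M[R]_d)) -> measurable_fun setT F ->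
  measurable_fun setT (fun w => mx_pow (F w : 'M[R]_d) p : borel_mx R d).
Proof.
move=> p0 psdF mF.
rewrite (_ : (fun w => _) =
    fun w => mx_apply (fun x => `|x| `^ p) (F w : 'M[R]_d)).
  apply: measurableT_comp mF; apply: measurable_mx_apply.
  exact: normr_powR_continuous.
apply/funext => w; apply: psd_apply_eq => // x; rewrite nnegrE => x0.
by rewrite ger0_norm.
Qed.

Lemma measurable_mx_abs dT' (T' : measurableType dT') (F : T' -> borel_mx R d) :
  measurable_fun setT F ->
  measurable_fun setT (fun w => mx_abs (F w : 'M[R]_d) : borel_mx R d).
Proof.
move=> mF; apply: measurableT_comp mF; apply: measurable_mx_apply.
exact: norm_continuous.
Qed.

Lemma measurable_loewner_le dT' (T' : measurableType dT')
    (F G : T' -> 'M[R]_d) :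
  (forall i j, measurable_fun setT (fun w => F w i j)) ->
  (forall i j, measurable_fun setT (fun w => G w i j)) ->
  measurable [set w | loewner_le (F w) (G w)].
Proof.
move=> mF mG; apply: measurable_psd_mx => i j.
by under eq_fun do rewrite 2!mxE; exact: measurable_funB.
Qed.

End functional_calculus.
End matrix_markov.

(** * Markov inequality randomized by a super-uniform matrix *)

Theorem theorem3p3 (R : realType) (disp : measure_display)
    (T : measurableType disp) (P : probability T R)
    (d : nat) (hd : (0 < d)%N)
    (X U : {RV P >-> borel_mx R d})
    (hX : forall w, (X w : 'M[R]_d) \is symmetricmx)
    (hU : super_uniform U)
    (hXU : independent_RV X U)
    (A : 'M[R]_d) (hA : pd_mx A)
    (q : R) (hq0 : 0 < q) (hq1 : q <= 1)
    (EX := mx_expectation P X)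
    (hEX : mx_integrable P X)
    (hEXq : mx_integrable P (fun w => mx_pow (mx_abs (X w - EX)) q)) :
  (P [set w | loewner_le
                (mx_pow (mx_pow A (q / 2) *m U w *m mx_pow A (q / 2)) q^-1)
                (mx_abs (X w - EX))]
   <= (d%:R^-1 *
       \tr (mx_expectation P (fun w => mx_pow (mx_abs (X w - EX)) q)
            *m mx_pow A (- q)))%:E)%E.
Proof.
have [psdU superU] := hU.
have mX : measurable_fun setT X by exact: measurable_funPT.
have mU : measurable_fun setT U by exact: measurable_funPT.
set H := mx_pow A (q / 2); set B := mx_pow A (- q).
pose K := mx_pow A (- (q / 2)).
have HT : H^T = H by exact: mx_pow_tr.
have KT : K^T = K by exact: mx_pow_tr.
(* The group law for powers of [A] makes [K] the inverse of [H] and its square equal to A^(-q). *)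
have [A0 AD _] := mx_pow_sym_group hA.
have HK : H *m K = 1%:M by rewrite /H /K -(AD (q / 2)) subrr.
have KH : K *m H = 1%:M by exact: mulmx1C.
have KK : K *m K = B by rewrite /B (splitr q) opprD AD.
clearbody H K B.
(* The deviation and [W] are functions of the matrix value rather than of the outcome, so that
   independence applies to [X] and [U] directly. *)
pose abs_dev (x : borel_mx R d) : 'M[R]_d := mx_abs ((x : 'M[R]_d) - EX).
pose W (x : borel_mx R d) : 'M[R]_d := K *m mx_pow (abs_dev x) q *m K.
have psd_dev x : psd_mx (abs_dev x) by exact: psd_mx_abs.
have psdW x : psd_mx (W x).
  by rewrite /W -{1}KT; apply: psd_conj; exact: psd_mx_pow.
have idc : continuous (fun x : 'M[R]_d => x) by move=> x S.
have m_dev : measurable_fun setT (abs_dev : borel_mx R d -> borel_mx R d).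
  apply: measurable_mx_abs.
  apply: (@continuous_measurable_mx _ _ (fun x : 'M[R]_d => x - EX)).
  by move=> x; exact: (cvgB (idc x) (@cst_continuous _ _ EX x)).
have mW i j : measurable_fun setT (fun x => W x i j).
  apply: measurable_mulmx => // {}i {}j; apply: measurable_mulmx => // {}i {}j.
  by apply: measurable_mx_coord; exact: measurable_mx_pow.
pose V w : 'M[R]_d := H *m U w *m H.
have psdV w : psd_mx (V w) by rewrite /V -{1}HT; exact: psd_conj.
have mV : measurable_fun setT (V : T -> borel_mx R d).
  pose HuH (u : borel_mx R d) : borel_mx R d := H *m u *m H.
  apply: (@measurableT_comp _ _ _ _ _ _ HuH _ U) => //.
  have cstc : continuous (fun _ : 'M[R]_d => H) by exact: cst_continuous.
  apply: (@continuous_measurable_mx _ _ HuH).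
  exact: (continuous_mulmx (continuous_mulmx cstc idc) cstc).
pose E := [set w | loewner_le (mx_pow (V w) q^-1) (abs_dev (X w))].
(* The section of [G] at x is the event of super-uniformity with Z = W(x). *)
pose G := [set p : borel_mx R d * borel_mx R d | loewner_le p.2 (W p.1)].
have mE : measurable E.
  apply: measurable_loewner_le => i j; apply: measurable_mx_coord; last first.
    exact: (measurableT_comp m_dev).
  by apply: measurable_mx_pow; rewrite ?invr_gt0.
have mG : measurable G.
  apply: measurable_loewner_le => i j.
    exact: measurable_mx_coord measurable_snd.
  exact: (measurableT_comp (mW i j) measurable_fst).
(* The power q undoes the power 1/q on the left side; conjugation by [K] then removes [H] on both
   sides of [U]. *)
have EG : E `<=` [set w | G (X w, U w)].
  move=> w /= Ew; have q01 : 0 < q <= 1 by rewrite hq0 hq1.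
  have := loewner_heinz (psd_mx_pow q^-1 (psdV w)) (psd_dev (X w)) q01 Ew.
  rewrite mx_powK// => /(loewner_conj K); rewrite /G /= KT /V !mulmxA KH mul1mx.
  by rewrite -mulmxA HK mulmx1.
have mXUG : measurable [set w | G (X w, U w)].
  rewrite -[X in measurable X]setTI.
  exact: (measurable_fun_pair mX mU measurableT mG).
apply: (le_trans (le_measure _ _ _ EG)); rewrite ?inE//.
(* Cyclicity of the trace merges the two factors [K]; the constant 1/d joins the deterministic
   factor, so the trace can be integrated as a linear form. *)
have trW x : \tr (W x) / d%:R =
    \tr (mx_pow (abs_dev x) q *m (d%:R^-1 *: B)).
  by rewrite /W -mulmxA mxtrace_mulC -mulmxA KK -scalemxAr mxtraceZ mulrC.
pose g (x : borel_mx R d) : \bar R := (\tr (W x) / d%:R)%:E.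
apply: (le_trans (independent_section_le (g := g) hXU mG _ _)).
- apply/measurable_EFinP; apply: measurable_funM => //.
  exact: measurable_fun_sumr.
- move=> x; apply: le_trans (superU (W x) (psdW x)).
  rewrite (_ : U @^-1` _ = [set w | loewner_le (U w) (W x)])//.
  by apply/seteqP; split=> w; rewrite /= xsectionE.
- under eq_integral do rewrite /g trW.
  by rewrite integral_mxtrace_mul// -scalemxAr mxtraceZ.
Qed.
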